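(* Let $(I,\preccurlyeq)$ be a directed set, let $S(\Lambda^{\succcurlyeq})$ be a contravariant direct spectrum over $(I,\preccurlyeq)$ with sets $\lambda_0(i)$, transports $\lambda^{\succcurlyeq}_{ji}$ and Bishop spaces $\mathcal F_i=(\lambda_0(i),F_i)$, let $(J,e,\mathrm{cof}_J)$ be a cofinal subset of $I$, and let $S(\Lambda^{\succcurlyeq})\circ e$ be the relative spectrum of $S(\Lambda^{\succcurlyeq})$ to $J$, with Bishop spaces $\mathcal F_j:=\mathcal F_{e(j)}$. Then $\underset{\leftarrow}{\mathrm{Lim}}\,\mathcal F_j\simeq\underset{\leftarrow}{\mathrm{Lim}}\,\mathcal F_i$, where the left side is the inverse limit of $S(\Lambda^{\succcurlyeq})\circ e$ over $J$.
   Context: Work in Bishop-style constructive mathematics (no choice principles). Each set has its own equality; functions respect it; $e$ is an embedding if $e(j)=e(j')\Rightarrow j=j'$. A directed set: a set with a reflexive transitive relation respecting equality, any two elements having a common upper bound. A contravariant direct family over $(I,\preccurlyeq)$: sets $\lambda_0(i)$ and, for $i\preccurlyeq j$, functions $\lambda^{\succcurlyeq}_{ji}:\lambda_0(j)\to\lambda_0(i)$ with $\lambda^{\succcurlyeq}_{ii}=\mathrm{id}$ and $\lambda^{\succcurlyeq}_{ki}=\lambda^{\succcurlyeq}_{ji}\circ\lambda^{\succcurlyeq}_{kj}$ for $i\preccurlyeq j\preccurlyeq k$. Bishop spaces: a Bishop topology on $X$ is a set $F$ of functions $X\to\mathbb R$ containing constants, closed under addition, composition with functions $\mathbb R\to\mathbb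 R$ uniformly continuous on every $[-n,n]$, and uniform limits; $\bigvee F_0$ = least Bishop topology containing $F_0$; Bishop morphism $(X,F)\to(Y,G)$: a function $h$ with $g\circ h\in F$ for all $g\in G$; Bishop isomorphism: bijective Bishop morphism with Bishop-morphism inverse; $\simeq$: Bishop isomorphic. A contravariant direct spectrum: a contravariant direct family with Bishop topologies $F_i$ such that all $\lambda^{\succcurlyeq}_{ji}$ are Bishop morphisms. Cofinal subset $(J,e,\mathrm{cof}_J)$: a set $J$, an embedding $e:J\to I$ (with $j\preccurlyeq j'$ iff $e(j)\preccurlyeq e(j')$), a function $\mathrm{cof}_J:I\to J$ with $\mathrm{cof}_J(e(j))=j$, $i\preccurlyeq i'\Rightarrow\mathrm{cof}_J(i)\preccurlyeq\mathrm{cof}_J(i')$, and $i\preccurlyeq e(\mathrm{cof}_J(i))$. The relative spectrum over $(J,\preccurlyeq)$ has sets $\lambda_0(e(j))$, transports $\lambda^{\succcurlyeq}_{e(j')e(j)}$ for $j\preccurlyeq j'$, topologies $F_{e(j)}$. Inverse limit: $\prod^{\succcurlyeq}\lambda_0(i)$ = dependent assignments $\Phi$ with $\Phi_i\in\lambda_0(i)$ and $\Phi_i=\lambda^{\succcurlyeq}_{ji}(\Phi_j)$ for $i\preccurlyeq j$ (pointwise equality); $\pi_i(\Phi)=\Phi_i$; $\underset{\leftarrow}{\mathrm{Lim}}\,\mathcal F_i=(\prod^{\succcurlyeq}\lambda_0(i),\bigvee\{f\circ\pi_i:i\in I,f\in F_i\})$. *)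

(* Defs.v *)
From Stdlib Require Import Reals RelationClasses.
Open Scope R_scope.

Record BSet := { bcar :> Type; beq : bcar -> bcar -> Prop;
                 beq_equiv : Equivalence beq }.
Arguments beq {b} _ _.

Definition respects {X Y : BSet} (f : X -> Y) : Prop :=
  forall x x', beq x x' -> beq (f x) (f x').

Definition embedding {X Y : BSet} (e : X -> Y) : Prop :=
  respects e /\ forall x x', beq (e x) (e x') -> beq x x'.

Record DirectedSet := {
  dcar :> BSet;
  dle : dcar -> dcar -> Prop;
  dle_refl : forall i, dle i i;
  dle_trans : forall i j k, dle i j -> dle j k -> dle i k;
  dle_resp : forall i i' j j', beq i i' -> beq j j' -> dle i j -> dle i' j';
  dle_dir : forall i j, exists k, dle i k /\ dle j k }.
Arguments dle {d} _ _.

Definition Bic (phi : R -> R) : Prop :=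
  forall (n : nat) (eps : R), 0 < eps -> exists delta, 0 < delta /\
    forall x y, Rabs x <= INR n -> Rabs y <= INR n -> Rabs (x - y) < delta ->
      Rabs (phi x - phi y) < eps.

Definition unif_conv {X : Type} (fs : nat -> X -> R) (f : X -> R) : Prop :=
  forall eps, 0 < eps -> exists N : nat, forall n, (N <= n)%nat ->
    forall x, Rabs (fs n x - f x) <= eps.

Definition IsBTop (X : BSet) (F : (X -> R) -> Prop) : Prop :=
  (forall f, F f -> forall x x', beq x x' -> f x = f x') /\
  (forall a : R, F (fun _ => a)) /\
  (forall f g, F f -> F g -> F (fun x => f x + g x)) /\
  (forall f phi, F f -> Bic phi -> F (fun x => phi (f x))) /\
  (forall fs f, (forall n, F (fs n)) -> unif_conv fs f -> F f).

Inductive BGen (X : BSet) (F0 : (X -> R) -> Prop) : (X -> R) -> Prop :=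
| bgen_base : forall f, F0 f -> BGen X F0 f
| bgen_const : forall a : R, BGen X F0 (fun _ => a)
| bgen_add : forall f g, BGen X F0 f -> BGen X F0 g ->
    BGen X F0 (fun x => f x + g x)
| bgen_comp : forall f phi, BGen X F0 f -> Bic phi ->
    BGen X F0 (fun x => phi (f x))
| bgen_lim : forall fs f, (forall n, BGen X F0 (fs n)) -> unif_conv fs f ->
    BGen X F0 f.

Record BSpace := { bset :> BSet; btop : (bset -> R) -> Prop }.

Definition BMorph {X Y : BSpace} (h : X -> Y) : Prop :=
  respects h /\ forall g, btop Y g -> btop X (fun x => g (h x)).

Definition BIso (X Y : BSpace) : Prop :=
  exists (h : X -> Y) (g : Y -> X),
    BMorph h /\ BMorph g /\
    (forall x, beq (g (h x)) x) /\ (forall y, beq (h (g y)) y).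

Record ContraSpectrum (I : DirectedSet) := {
  lam0 : I -> BSet;
  lam1 : forall i j : I, dle i j -> lam0 j -> lam0 i;
  lam1_resp : forall i j (p : dle i j), respects (lam1 i j p);
  lam1_id : forall i (p : dle i i) x, beq (lam1 i i p x) x;
  lam1_comp : forall i j k (pij : dle i j) (pjk : dle j k) (pik : dle i k) x,
      beq (lam1 i k pik x) (lam1 i j pij (lam1 j k pjk x));
  topo : forall i, (lam0 i -> R) -> Prop;
  topo_btop : forall i, IsBTop (lam0 i) (topo i);
  lam1_morph : forall i j (p : dle i j) g, topo i g ->
      topo j (fun x => g (lam1 i j p x)) }.
Arguments lam0 {I} _ _.
Arguments lam1 {I} _ _ _ _ _.
Arguments topo {I} _ _ _.

(* Cofinal subset (J, e, cof_J) of a directed set I; J carries the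
   preorder j <= j' iff e j <= e j'. *)
Record Cofinal (I : DirectedSet) := {
  cJ : BSet;
  ce : cJ -> I;
  ccof : I -> cJ;
  ce_emb : embedding ce;
  ccof_resp : respects ccof;
  ccof_e : forall j, beq (ccof (ce j)) j;
  ccof_mono : forall i i' : I, dle i i' -> dle (ce (ccof i)) (ce (ccof i'));
  ccof_up : forall i : I, dle i (ce (ccof i)) }.
Arguments cJ {I} _.
Arguments ce {I} _ _.
Arguments ccof {I} _ _.

Section InvLim.
Variables (I : BSet) (le : I -> I -> Prop) (l0 : I -> BSet)
  (l1 : forall i j, le i j -> l0 j -> l0 i)
  (F : forall i, (l0 i -> R) -> Prop).

Definition LimCar : Type :=
  { Phi : forall i, l0 i |
    forall i j (p : le i j), beq (Phi i) (l1 i j p (Phi j)) }.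

Definition LimEq (a b : LimCar) : Prop :=
  forall i, beq (proj1_sig a i) (proj1_sig b i).

Lemma LimEq_equiv : Equivalence LimEq.
Proof.
  split.
  - intros a i. apply (@Equivalence_Reflexive _ _ (beq_equiv (l0 i))).
  - intros a b H i. apply (@Equivalence_Symmetric _ _ (beq_equiv (l0 i))), H.
  - intros a b c H1 H2 i.
    exact (@Equivalence_Transitive _ _ (beq_equiv (l0 i)) _ _ _ (H1 i) (H2 i)).
Qed.

Definition LimSet : BSet := {| bcar := LimCar; beq := LimEq;
                               beq_equiv := LimEq_equiv |}.

Definition proj (i : I) (a : LimSet) : l0 i := proj1_sig a i.

Definition LimSubbase (h : LimSet -> R) : Prop :=
  exists i (f : l0 i -> R), F i f /\ forall a, h a = f (proj i a).

Definition InvLim : BSpace := {| bset := LimSet; btop := BGen LimSet LimSubbase |}.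
End InvLim.

Definition SpecLim {I : DirectedSet} (S : ContraSpectrum I) : BSpace :=
  InvLim I (@dle I) (lam0 S) (lam1 S) (topo S).

Definition RelLim {I : DirectedSet} (S : ContraSpectrum I) (C : Cofinal I)
  : BSpace :=
  InvLim (cJ C) (fun j j' => dle (ce C j) (ce C j'))
    (fun j => lam0 S (ce C j))
    (fun j j' p => lam1 S (ce C j) (ce C j') p)
    (fun j => topo S (ce C j)).

(* Main.v *)
(* A thread over the cofinal part J extends uniquely to a thread over I: at
   i, transport the J-component at cof(i), which lies above i.  Compatibility
   of the extension and both round trips reduce to the composition law of the
   transports.  Both maps are Bishop morphisms because the limit topologies
   are the least ones containing the subbasic functions f o pi_i, and each
   map sends subbasic functions to subbasic functions (for the extension,
   f o pi_i becomes (f o lambda) o pi_cof(i), and f o lambda is in F_e(cof i)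
   since the transports are Bishop morphisms). *)
Require Import Defs.
From Stdlib Require Import Reals RelationClasses.

#[local] Existing Instance beq_equiv.

Definition BClosed (X : BSet) (G : (X -> R) -> Prop) : Prop :=
  (forall a : R, G (fun _ => a)) /\
  (forall f g, G f -> G g -> G (fun x => f x + g x)) /\
  (forall f phi, G f -> Bic phi -> G (fun x => phi (f x))) /\
  (forall fs f, (forall n, G (fs n)) -> unif_conv fs f -> G f).

Lemma BGen_closed (X : BSet) (F0 : (X -> R) -> Prop) : BClosed X (BGen X F0).
Proof.
  split; [|split; [|split]].
  - apply bgen_const.
  - apply bgen_add.
  - apply bgen_comp.
  - apply bgen_lim.
Qed.

Lemma BGen_least (X : BSet) (F0 G : (X -> R) -> Prop) :
  (forall f, F0 f -> G f) -> BClosed X G -> forall g, BGen X F0 g -> G g.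
Proof.
  intros HF0 [Hconst [Hadd [Hcomp Hlim]]] g Hg.
  induction Hg; eauto.
Qed.

(* A constant sequence converges uniformly to any pointwise equal function. *)
Lemma BClosed_ext (X : BSet) (G : (X -> R) -> Prop) (f g : X -> R) :
  BClosed X G -> G f -> (forall x, g x = f x) -> G g.
Proof.
  intros (_ & _ & _ & Hlim) Hf Hgf.
  apply (Hlim (fun _ => f)); [easy|].
  intros eps Heps; exists 0%nat; intros n _ x.
  rewrite Hgf, Rminus_diag, Rabs_R0; now apply Rlt_le.
Qed.

Lemma BClosed_precomp (X Y : BSet) (G : (X -> R) -> Prop) (m : X -> Y) :
  BClosed X G -> BClosed Y (fun g => G (fun x => g (m x))).
Proof.
  intros [Hconst [Hadd [Hcomp Hlim]]].
  split; [|split; [|split]]; intros *; eauto.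
  intros Hfs Hconv; apply (Hlim (fun n x => fs n (m x))); [easy|].
  intros eps Heps; destruct (Hconv eps Heps) as [N HN].
  exists N; intros n Hn x; apply HN, Hn.
Qed.

Section InvLimLift.
Variables (I : BSet) (le : I -> I -> Prop) (l0 : I -> BSet)
  (l1 : forall i j, le i j -> l0 j -> l0 i)
  (F : forall i, (l0 i -> R) -> Prop).

Lemma InvLim_BMorph_lift (X : BSpace) (h : X -> InvLim I le l0 l1 F) :
  BClosed X (btop X) -> respects h ->
  (forall i f, F i f -> btop X (fun x => f (proj1_sig (h x) i))) ->
  BMorph h.
Proof.
  intros HX Hh Hsub; split; [exact Hh|].
  apply BGen_least; [|now apply BClosed_precomp].
  intros g (i & f & Hf & Hg).
  apply (BClosed_ext _ _ _ _ HX (Hsub i f Hf)); intros x; apply Hg.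
Qed.

End InvLimLift.

Section CofinalLimit.
Variables (I : DirectedSet) (S : ContraSpectrum I) (C : Cofinal I).

Let e := ce C.
Let cof := ccof C.

Lemma rel_thread_transport (a : RelLim S C) j j'
    (pjj' : dle (e j) (e j')) i (p : dle i (e j)) (p' : dle i (e j')) :
  beq (lam1 S i (e j') p' (proj1_sig a j')) (lam1 S i (e j) p (proj1_sig a j)).
Proof.
  etransitivity; [apply (lam1_comp I S _ _ _ p pjj')|].
  apply lam1_resp; symmetry; apply (proj2_sig a).
Qed.

Definition lim_extend_fam (a : RelLim S C) (i : I) : lam0 S i :=
  lam1 S i (e (cof i)) (ccof_up I C i) (proj1_sig a (cof i)).

Lemma lim_extend_thread (a : RelLim S C) i i' (p : dle i i') :
  beq (lim_extend_fam a i) (lam1 S i i' p (lim_extend_fam a i')).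
Proof.
  pose proof (dle_trans I _ _ _ p (ccof_up I C i')) as pi.
  symmetry; etransitivity; [symmetry; apply (lam1_comp I S _ _ _ p _ pi)|].
  apply rel_thread_transport, (ccof_mono I C _ _ p).
Qed.

Definition lim_extend (a : RelLim S C) : SpecLim S :=
  exist _ (lim_extend_fam a) (lim_extend_thread a).

Definition lim_restrict (b : SpecLim S) : RelLim S C :=
  exist (fun Phi => forall j j' (p : dle (e j) (e j')),
                      beq (Phi j) (lam1 S (e j) (e j') p (Phi j')))
    (fun j => proj1_sig b (e j)) (fun j j' => proj2_sig b (e j) (e j')).

Lemma lim_extend_BMorph : BMorph lim_extend.
Proof.
  apply InvLim_BMorph_lift; [apply BGen_closed| |].
  - intros a a' Haa' i; apply lam1_resp, Haa'.
  - intros i f Hf; apply bgen_base.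
    exists (cof i), (fun y => f (lam1 S i _ (ccof_up I C i) y)).
    split; [now apply lam1_morph | easy].
Qed.

Lemma lim_restrict_BMorph : BMorph lim_restrict.
Proof.
  apply InvLim_BMorph_lift; [apply BGen_closed| |].
  - intros b b' Hbb' j; apply Hbb'.
  - intros j f Hf; apply bgen_base.
    exists (e j), f; split; easy.
Qed.

Lemma lim_restrict_extend (a : RelLim S C) :
  beq (lim_restrict (lim_extend a)) a.
Proof. intros j; symmetry; apply (proj2_sig a j (cof (e j))). Qed.

Lemma lim_extend_restrict (b : SpecLim S) :
  beq (lim_extend (lim_restrict b)) b.
Proof. intros i; symmetry; apply (proj2_sig b). Qed.

End CofinalLimit.

Theorem theorem10p5 (I : DirectedSet) (S : ContraSpectrum I) (C : Cofinal I) :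
  BIso (RelLim S C) (SpecLim S).
Proof.
  exists (lim_extend I S C), (lim_restrict I S C).
  split; [|split; [|split]].
  - apply lim_extend_BMorph.
  - apply lim_restrict_BMorph.
  - apply lim_restrict_extend.
  - apply lim_extend_restrict.
Qed.
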